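(* Let $n \geq 1$ be an integer and let $A$ be a symmetric $n \times n$ matrix with rational entries which lies in the interior of the cone $\mathcal{CP}_n$ of completely positive matrices. Then $A$ has a rational cp-factorization, i.e. there exist a natural number $m$, rational numbers $\alpha_1, \ldots, \alpha_m \geq 0$ and vectors $x_1, \ldots, x_m \in \mathbb{Q}^n$ with nonnegative entries such that \[ A = \sum_{i=1}^m \alpha_i x_i x_i^{\mathsf{T}}. \]
   Context: Let $\mathcal{S}^n$ denote the real vector space of symmetric $n \times n$ matrices, a Euclidean space with inner product $\langle A, B\rangle = \mathrm{Trace}(AB) = \sum_{i,j=1}^n A_{ij}B_{ij}$. The cone of completely positive matrices is the convex cone \[ \mathcal{CP}_n = \mathrm{cone}\{xx^{\mathsf{T}} : x \in \mathbb{R}^n_{\geq 0}\} \subseteq \mathcal{S}^n, \] i.e. the set of all finite sums $\sum_i \alpha_i x_i x_i^{\mathsf{T}}$ with real $\alpha_i \geq 0$ and $x_i \in \mathbb{R}^n_{\geq 0}$ (vectors with nonnegative entries). The interior of $\mathcal{CP}_n$ is its topological interior in $\mathcal{S}^n$. A cp-factorization of a matrix $A$ is a representation $A = \sum_{i=1}^m \alpha_i x_i x_i^{\mathsf{T}}$ with $\alpha_i \geq 0$ and $x_i \in \mathbb{R}^n_{\geq 0}$ for $i = 1, \ldots, m$; it is called rational if all $\alpha_i$ are rational numbers and all $x_i$ are rational vectors. *)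

(* Defs.v *)
From HB Require Import structures.
From mathcomp Require Import all_boot all_order all_algebra.
From mathcomp Require Import all_classical all_reals all_analysis.

Set Implicit Arguments.
Unset Strict Implicit.
Unset Printing Implicit Defensive.

Import Order.TTheory GRing.Theory Num.Theory.
Import numFieldNormedType.Exports.

Local Open Scope classical_set_scope.
Local Open Scope ring_scope.

Definition sym_mx (F : numDomainType) (n : nat) : set 'M[F]_n :=
  [set A | A^T = A].

(* Over the reals this is a cp-factorization; over [rat] it is a rational
   cp-factorization. *)
Definition cp_factorization (F : numDomainType) (n : nat) (A : 'M[F]_n)
    (m : nat) (alpha : 'I_m -> F) (x : 'I_m -> 'cV[F]_n) : Prop :=
  [/\ forall i, 0 <= alpha i,
      forall i j, 0 <= x i j 0
    & A = \sum_(i < m) alpha i *: (x i *m (x i)^T)].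

Definition CP (R : realType) (n : nat) : set 'M[R]_n :=
  [set A | exists (m : nat) (alpha : 'I_m -> R) (x : 'I_m -> 'cV[R]_n),
     cp_factorization A alpha x].

(* The interior is relative to the space of symmetric matrices: in the space of
   all n x n matrices the cone has empty interior as soon as n >= 2.  The type
   [subspace S] carries the induced topology at the points of [S] and isolates
   the points outside [S]; the latter play no role since CP is contained in
   [sym_mx]. *)
Definition CP_interior (R : realType) (n : nat) : set 'M[R]_n :=
  interior (@CP R n : set (subspace (@sym_mx R n))).

(* Main.v *)
(* The symmetric matrices with nonnegative off-diagonal entries that are
   diagonally dominant have an explicit factorization into multiples of
   e_i e_i^T and (e_i + e_j)(e_i + e_j)^T, over any ordered field.  If A is
   interior, then A - eps B is completely positive for a strictly diagonally
   dominant, entrywise positive matrix B and a small rational eps > 0.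
   Rounding a real factorization of A - eps B to a rational one yields a
   rational matrix D close to A - eps B; then A - D is close to eps B, hence
   diagonally dominant with nonnegative entries, and the factorizations of D and
   A - D add up to one of A. *)
Require Import Defs.
From mathcomp Require Import all_boot all_order all_algebra.
From mathcomp Require Import all_classical all_reals all_analysis.
From mathcomp Require Import ring lra.

Set Implicit Arguments.
Unset Strict Implicit.
Unset Printing Implicit Defensive.

Import Order.TTheory GRing.Theory Num.Theory.
Import numFieldNormedType.Exports.

Local Open Scope classical_set_scope.
Local Open Scope ring_scope.

Definition has_cp (F : numDomainType) (n : nat) (A : 'M[F]_n) : Prop :=
  exists (m : nat) (alpha : 'I_m -> F) (x : 'I_m -> 'cV[F]_n),
    cp_factorization A alpha x.

Lemma has_cp0 (F : numDomainType) (n : nat) : has_cp (0 : 'M[F]_n).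
Proof.
exists 0%N, (fun=> 0), (fun=> 0).
by split=> [i|i j|]; rewrite ?mxE ?big_ord0.
Qed.

Lemma has_cpD (F : numDomainType) (n : nat) (A B : 'M[F]_n) :
  has_cp A -> has_cp B -> has_cp (A + B).
Proof.
move=> [m1 [a [x [a0 x0 ->]]]] [m2 [b [y [b0 y0 ->]]]].
pose sel T (f : 'I_m1 -> T) (g : 'I_m2 -> T) (k : 'I_(m1 + m2)) :=
  match fintype.split k with inl i => f i | inr j => g j end.
have selL T f g i : @sel T f g (lshift m2 i) = f i.
  by rewrite /sel -[lshift _ _]/(unsplit (inl i)) unsplitK.
have selR T f g j : @sel T f g (rshift m1 j) = g j.
  by rewrite /sel -[rshift _ _]/(unsplit (inr j)) unsplitK.
exists (m1 + m2)%N, (sel _ a b), (sel _ x y); split.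
- by move=> k; rewrite /sel; case: fintype.split.
- by move=> k j; rewrite /sel; case: fintype.split.
- rewrite big_split_ord /=; congr (_ + _).
    by apply: eq_bigr => i _; rewrite !selL.
  by apply: eq_bigr => i _; rewrite !selR.
Qed.

Lemma has_cp_rank1 (F : numDomainType) (n : nat) (a : F) (x : 'cV[F]_n) :
  0 <= a -> (forall j, 0 <= x j 0) -> has_cp (a *: (x *m x^T)).
Proof.
move=> a0 x0; exists 1%N, (fun=> a), (fun=> x).
by split=> //; rewrite big_ord1.
Qed.

Lemma has_cp_sum (F : numDomainType) (n : nat) (I : finType) (P : pred I)
    (A : I -> 'M[F]_n) :
  (forall i, P i -> has_cp (A i)) -> has_cp (\sum_(i | P i) A i).
Proof.
by apply: big_ind; [exact: has_cp0 | exact: has_cpD].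
Qed.

(** The term (e_i + e_j)(e_i + e_j)^T produces the off-diagonal entries but also adds to the
    diagonal at i and j; dominance says exactly that the diagonal can pay for this excess. *)
Lemma has_cp_diag_dominant (F : numFieldType) (n : nat) (C : 'M[F]_n) :
  C^T = C -> (forall i j, i != j -> 0 <= C i j) ->
  (forall i, \sum_(j | j != i) C i j <= C i i) -> has_cp C.
Proof.
move=> symC C0 domC.
pose e (i : 'I_n) : 'cV[F]_n := delta_mx i 0.
have ee i j : e i *m (e j)^T = delta_mx i j.
  by rewrite /e trmx_delta mul_delta_mx.
have e0 i j : 0 <= e i j 0 by rewrite mxE ler0n.
pose D i j := if j != i then C i j else 0.
have DC i j : D i j = D j i.
  by rewrite /D eq_sym; case: ifP => // _; rewrite -{1}symC mxE.
have D0 i j : 0 <= D i j.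
  by rewrite /D; case: ifP => // ji; apply: C0; rewrite eq_sym.
(* The double sum meets each unordered pair twice, hence the weight [D i j / 2]. *)
have -> : C = \sum_i (C i i - \sum_j D i j) *: (e i *m (e i)^T) +
    \sum_i \sum_j (D i j / 2) *: ((e i + e j) *m (e i + e j)^T).
  have expand i j : (D i j / 2) *: ((e i + e j) *m (e i + e j)^T) =
      ((D i j / 2) *: delta_mx i i + (D i j / 2) *: delta_mx i j) +
      ((D i j / 2) *: delta_mx j j + (D i j / 2) *: delta_mx j i).
    rewrite linearD mulmxDl !mulmxDr !ee -!scalerDr; congr (_ *: _).
    by rewrite [in RHS](addrC (delta_mx j j)).
  under [X in _ + X]eq_bigr do
    (under eq_bigr do rewrite expand; rewrite big_split /=).
  (* Swapping the indices and using the symmetry of [D] makes the second group of terms equal to the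
     first, so that the halves add up. *)
  rewrite big_split /= [X in _ + (_ + X)]exchange_big /=.
  under [X in _ + (_ + X)]eq_bigr do
    (under eq_bigr do rewrite DC).
  rewrite -big_split /= -big_split /= {1}(matrix_sum_delta C).
  apply: eq_bigr => i _.
  rewrite -big_split /= scalerBl scaler_suml ee -addrA addrC -sumrN -big_split /=.
  rewrite (bigD1 i) //= [in RHS](bigD1 i) //= /D eqxx /= mul0r !scale0r.
  rewrite oppr0 !addr0 add0r addrC; congr (_ + _).
  apply: eq_bigr => j ->.
  have half (c : F) : c / 2 + c / 2 = c by rewrite -splitr.
  by rewrite addrACA -2!(scalerDl _ (_ / 2)) half addrA addNr add0r.
apply: has_cpD; apply: has_cp_sum => i _.
  apply: has_cp_rank1 => //; rewrite subr_ge0.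
  by rewrite /D -big_mkcond.
apply: has_cp_sum => j _; apply: has_cp_rank1 => [|k].
  by rewrite divr_ge0.
by rewrite mxE addr_ge0.
Qed.

(** The factors are replaced one at a time. Since d <= 1 <= M, replaced factors are at most 2M, and
    7 = 4 + 2 + 1 collects the three terms. *)
Lemma prod3_approx (R : realFieldType) (M d a b c a' b' c' : R) :
  1 <= M -> 0 <= d <= 1 ->
  0 <= a <= M -> 0 <= b <= M -> 0 <= c <= M ->
  a <= a' <= a + d -> b <= b' <= b + d -> c <= c' <= c + d ->
  `|a' * (b' * c') - a * (b * c)| <= d * (7 * M ^+ 2).
Proof.
move=> M1 /andP[d0 d1] /andP[a0 aM] /andP[b0 bM] /andP[c0 cM].
move=> /andP[aa' a'd] /andP[bb' b'd] /andP[cc' c'd].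
have M0 : 0 <= M by lra.
rewrite ger0_norm; last by rewrite subr_ge0 !ler_pM ?mulr_ge0.
have -> : a' * (b' * c') - a * (b * c) =
    (a' - a) * (b' * c') + (b' - b) * (a * c') + (c' - c) * (a * b) by ring.
have -> : d * (7 * M ^+ 2) =
    d * ((2 * M) * (2 * M)) + d * (M * (2 * M)) + d * (M * M) by ring.
have b'0 : 0 <= b' by lra.
have c'0 : 0 <= c' by lra.
apply: lerD; first apply: lerD.
all: apply: ler_pM; [lra | by rewrite mulr_ge0 | lra | apply: ler_pM; lra].
Qed.

(** Rounding upwards keeps nonnegative numbers nonnegative, so rounded factorizations stay valid. *)
Lemma rat_approx_above (R : realType) (r d : R) :
  0 < d -> exists q : rat, r <= ratr q <= r + d.
Proof.
move=> d0; have /rat_in_itvoo[q] : r < r + d by rewrite ltrDl.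
by rewrite in_itv /= => /andP[/ltW rq /ltW qr]; exists q; rewrite rq qr.
Qed.

Lemma cp_rat_approx (R : realType) (n : nat) (A : 'M[R]_n) (eps : R) :
  has_cp A -> 0 < eps ->
  exists2 D : 'M[rat]_n, has_cp D &
    forall i j, `|ratr (D i j) - A i j| <= eps.
Proof.
move=> [m [a [x [a0 x0 ->]]]] eps0.
(* A common bound, at least 1, for all weights and all vector entries. *)
pose M := 1 + \sum_i a i + \sum_i \sum_j x i j 0.
have suma0 : 0 <= \sum_i a i by exact: sumr_ge0.
have sumx0 i : 0 <= \sum_j x i j 0 by exact: sumr_ge0.
have sumxx0 : 0 <= \sum_i \sum_j x i j 0 by exact: sumr_ge0.
have M1 : 1 <= M by rewrite /M; lra.
have aM i : 0 <= a i <= M.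
  rewrite a0 /M (bigD1 i) //=.
  have : 0 <= \sum_(k | k != i) a k by exact: sumr_ge0.
  lra.
have xM i j : 0 <= x i j 0 <= M.
  rewrite x0 /=; have : x i j 0 <= \sum_k \sum_l x k l 0.
    by rewrite (bigD1 i) //= (bigD1 j) //= -addrA lerDl addr_ge0 ?sumr_ge0.
  rewrite /M; lra.
(* Each of the [m] terms has error at most d * 7M^2; the successor keeps [K] positive when [m] is
   0. *)
pose K := m.+1%:R * (7 * M ^+ 2).
have K0 : 0 < K.
  by rewrite /K !mulr_gt0 ?exprn_gt0 ?ltr0n //; lra.
pose d := Num.min 1 (eps / K).
have d0 : 0 < d by rewrite lt_min ltr01 divr_gt0.
have d1 : d <= 1 by rewrite ge_min lexx.
have dK : d * K <= eps by rewrite -ler_pdivlMr // ge_min lexx orbT.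
have [a' a'P] := choice (fun i => rat_approx_above (a i) d0).
have [x' x'P] := choice (fun ij => rat_approx_above (x ij.1 ij.2 0) d0).
exists (\sum_i a' i *: ((\col_j x' (i, j)) *m (\col_j x' (i, j))^T)).
  apply: has_cp_sum => i _; apply: has_cp_rank1 => [|j].
    by have /andP[/(le_trans (a0 i))] := a'P i; rewrite ler0q.
  rewrite mxE; have /andP[/(le_trans (x0 i j))] := x'P (i, j).
  by rewrite ler0q.
move=> i j; rewrite !summxE rmorph_sum /= -sumrB.
apply: le_trans (ler_norm_sum _ _ _) _.
apply: (@le_trans _ _ (\sum_(k < m) d * (7 * M ^+ 2))).
  apply: ler_sum => k _.
  rewrite !mxE !big_ord1 !mxE !rmorphM /=.
  apply: prod3_approx => //; first by rewrite (ltW d0).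
    exact: x'P (k, i).
  exact: x'P (k, j).
rewrite sumr_const card_ord -[leLHS]mulr_natl; apply: le_trans dK.
rewrite /K mulrCA ler_wpM2l ?(ltW d0) // ler_wpM2r ?ler_nat //.
by rewrite mulr_ge0 ?sqr_ge0.
Qed.

Lemma CP_interior_sub (R : realType) (n : nat) (A B : 'M[R]_n) :
  A^T = A -> B^T = B -> @CP_interior R n A ->
  exists2 eps : rat, 0 < eps & has_cp (A - ratr eps *: B).
Proof.
move=> symA symB hA.
(* At a symmetric point the subspace neighbourhoods are traces of matrix neighbourhoods, so the
   perturbation must be both entrywise small and symmetric. *)
have : within (@sym_mx R n) (nbhs A) (@CP R n) by rewrite nbhs_subspace_in.
rewrite /within /= => /nbhs_ballP[e /= e0 he].
pose M := 1 + \sum_i \sum_j `|B i j|.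
have M1 : 1 <= M.
  by rewrite lerDl; apply: sumr_ge0 => i _; exact: sumr_ge0.
have BM i j : `|B i j| <= M.
  rewrite /M (bigD1 i) //= (bigD1 j) //=.
  have : 0 <= \sum_(k | k != j) `|B i k| by exact: sumr_ge0.
  have : 0 <= \sum_(k | k != i) \sum_l `|B k l|.
    by apply: sumr_ge0 => k _; exact: sumr_ge0.
  lra.
have M0 : 0 < M by lra.
have /rat_in_itvoo[q] : 0 < e / M by rewrite divr_gt0.
rewrite in_itv /= => /andP[q0 qM]; rewrite ltr0q in q0.
exists q => //; apply: he; last first.
  by rewrite /sym_mx /= linearB linearZ /= symA symB.
split=> // i j; rewrite /ball /= !mxE opprB addrC subrK normrM ger0_norm ?ler0q ?ltW //.
move: qM; rewrite ltr_pdivlMr // => /(le_lt_trans _); apply.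
by rewrite ler_wpM2l // ler0q ltW.
Qed.

Theorem theorem1p1 (R : realType) (n : nat) (hn : (1 <= n)%N) (A : 'M[rat]_n)
    (hsym : A^T = A)
    (hint : @CP_interior R n (map_mx ratr A)) :
  exists (m : nat) (alpha : 'I_m -> rat) (x : 'I_m -> 'cV[rat]_n),
    cp_factorization A alpha x.
Proof.
(* An entrywise error of [eps] around [eps * B] leaves off-diagonal entries in [0, 2 eps] and
   diagonal entries at least 2n eps, which dominates the row. [B] is needed over both [R] and
   [rat]. *)
pose B (F : numFieldType) : 'M[F]_n := const_mx 1 + (2 * n)%:R%:M.
have symB F : (B F)^T = B F by rewrite linearD /= trmx_const tr_scalar_mx.
have symA : (map_mx ratr A)^T = map_mx ratr A :> 'M[R]_n.
  by apply/matrixP => i j; rewrite !mxE -{1}hsym mxE.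
have [eps eps0 cpAB] := @CP_interior_sub _ _ _ (B R) symA (symB R) hint.
have eps0' : 0 < ratr eps :> R by rewrite ltr0q.
have [D cpD DP] := cp_rat_approx cpAB eps0'.
have symD : D^T = D.
  have [m [a [x [_ _ ->]]]] := cpD.
  rewrite linear_sum; apply: eq_bigr => i _.
  by rewrite linearZ /= trmx_mul trmxK.
(* [ratr] preserves order and absolute value, so the estimate descends to [rat], where [A - D] is to
   be factored. *)
have {}DP i j : `|D i j - (A i j - eps * B rat i j)| <= eps.
  rewrite -(ler_rat R) ratr_norm !rmorphB rmorphM /=.
  by move: (DP i j); rewrite !mxE -!mulrnA !nat1r ratr_nat.
suff: has_cp (A - D) by move=> /has_cpD/(_ cpD); rewrite subrK.
apply: has_cp_diag_dominant => [|i j ij|i].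
- by rewrite linearB /= hsym symD.
- have := DP i j; rewrite !mxE (negbTE ij) mulr0n addr0 mulr1 ler_norml => /andP[]; lra.
- apply: (@le_trans _ _ (\sum_(j | j != i) 2 * eps)).
    apply: ler_sum => j; rewrite eq_sym => ij.
    have := DP i j; rewrite !mxE (negbTE ij) mulr0n addr0 mulr1 ler_norml => /andP[]; lra.
  apply: (@le_trans _ _ ((2 * n)%:R * eps)).
    rewrite sumr_const -[leLHS]mulr_natl natrM mulrCA mulrA ler_wpM2r ?(ltW eps0) //.
    rewrite ler_wpM2l // ler_nat.
    by rewrite -[leqRHS]card_ord max_card.
  have := DP i i; rewrite !mxE eqxx mulr1n mulrDr mulr1 [eps * _]mulrC ler_norml => /andP[]; lra.
Qed.
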